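(* For integers $m,p\geq1$, \[ \sum_{n=1}^\infty\frac{H_nH_n^{(m+1)}\binom{2n}{n}}{4^n n^p} =4\zeta(\bar{1},\tilde{1},\{\hat{1}\}_{p-1},\hat{2},\{\hat{1}\}_{m-1}) -4\zeta(\tilde{2},\{\hat{1}\}_{p-1},\hat{2},\{\hat{1}\}_{m-1}) +\zeta(m+1)\sum_{n=1}^\infty\frac{H_n\binom{2n}{n}}{4^n n^p}\,. \]
   Context: $H_n^{(s)}=\sum_{k=1}^n k^{-s}$, $H_n=H_n^{(1)}$, $\zeta$ the Riemann zeta function. Mixed multiple zeta values: for positive integers $s_1,\dots,s_r$, each possibly decorated by a bar, hat or tilde, $\zeta(s_1,\dots,s_r):=\sum_{n_1>n_2>\cdots>n_r\geq 1}\prod_{j=1}^r \frac{\epsilon_j(n_j)}{n_j^{s_j}}$, where $\epsilon_j(n)=1$ for undecorated $s_j$, $(-1)^n$ for $\bar s_j$, $1+(-1)^n$ for $\hat s_j$, and $1-(-1)^n$ for $\tilde s_j$. $\{a\}_k$ denotes $k$ repetitions of $a$ ($\{a\}_0$ empty). *)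

(* Defs.v *)
From HB Require Import structures.
From mathcomp Require Import all_boot all_order all_algebra.
From mathcomp Require Import all_classical all_reals all_analysis.

Set Implicit Arguments.
Unset Strict Implicit.
Unset Printing Implicit Defensive.

Import Order.TTheory GRing.Theory Num.Theory.
Import numFieldNormedType.Exports.

Local Open Scope classical_set_scope.
Local Open Scope ring_scope.

(* H_n^(s) *)
Definition gharm (R : realType) (s n : nat) : R :=
  \sum_(1 <= k < n.+1) (k%:R ^+ s)^-1.

Variant decoration := Plain | Bar | Hat | Tilde.

Definition mzv_entry : Type := (nat * decoration)%type.

Definition plain_ (s : nat) : mzv_entry := (s, Plain).
Definition bar_ (s : nat) : mzv_entry := (s, Bar).
Definition hat_ (s : nat) : mzv_entry := (s, Hat).
Definition tilde_ (s : nat) : mzv_entry := (s, Tilde).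

Definition deco_coef (R : realType) (d : decoration) (n : nat) : R :=
  match d with
  | Plain => 1
  | Bar => (-1) ^+ n
  | Hat => 1 + (-1) ^+ n
  | Tilde => 1 - (-1) ^+ n
  end.

(* The nested sum over N > n_1 > n_2 > ... > n_r >= 1, the head of the list
   being the entry attached to the largest index n_1. *)
Fixpoint mmzv_trunc (R : realType) (s : seq mzv_entry) (N : nat) : R :=
  match s with
  | [::] => 1
  | (k, d) :: s' =>
      \sum_(1 <= n < N) deco_coef R d n / n%:R ^+ k * mmzv_trunc R s' n
  end.

(* The infinite sum is taken as the limit over the bound N on the outermost
   index n_1: with leading entry (1, Bar) it converges only conditionally.
   [limn] is total, so convergence has to be asserted separately. *)
Definition mmzv_cvg (R : realType) (s : seq mzv_entry) : Prop :=
  cvgn (mmzv_trunc R s).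

Definition mmzv (R : realType) (s : seq mzv_entry) : R :=
  limn (mmzv_trunc R s).

(* Riemann zeta at an integer s >= 2. *)
Definition zeta_nat (R : realType) (s : nat) : R := mmzv R [:: plain_ s].

(* Partial sums, over 1 <= n < N, of a_n binom(2n, n) / (4^n n^p). *)
Definition apery_partial (R : realType) (a : nat -> R) (p N : nat) : R :=
  \sum_(1 <= n < N) a n * 'C(2 * n, n)%:R / (4 ^+ n * n%:R ^+ p).

Definition apery_cvg (R : realType) (a : nat -> R) (p : nat) : Prop :=
  cvgn (apery_partial a p).

Definition apery_sum (R : realType) (a : nat -> R) (p : nat) : R :=
  limn (apery_partial a p).

(* Main.v *)
(** Let [a_n = C(2n, n) / 4^n] and [t_n = zeta(m+1) - H_n^(m+1)]; the claim
    evaluates the sum of [a_n H_n t_n / n^p].  The connector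
    [n! b! / (n+b)!] satisfies
      [conn n b - conn n (b+1) = n / (b+1) * conn n (b+1)],
    so that multiplying by [1 / n] amounts to summing [conn n b' / b'] over
    [b' > b].  Iterating this, [t_n / n^p] becomes the sum over [b] of
    [V b / b * conn n b], where [V] is the truncated nested sum attached to
    [{1}_(p-1), 2, {1}_(m-1)].  The remaining sum over [n] of
    [a_n H_n conn n b / b] telescopes, by Abel summation, to
    [4 tau_b / (2b-1)], where [tau_b] is the sum over [n >= 2b-1] of
    [(-1)^(n+1) / n]: splitting off the first term of [tau_b] produces the two
    mixed multiple zeta values. *)

Require Import Defs.
From mathcomp Require Import all_boot all_order all_algebra.
From mathcomp Require Import all_classical all_reals all_analysis.
From mathcomp Require Import ring lra zify.

Set Implicit Arguments.
Unset Strict Implicit.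
Unset Printing Implicit Defensive.

Import Order.TTheory GRing.Theory Num.Theory.
Import numFieldNormedType.Exports.
Local Open Scope classical_set_scope.
Local Open Scope ring_scope.

(** * Convergent series *)

Section series_lemmas.
Variable R : realType.
Implicit Types (u v w c : nat -> R) (a l s : R).

Lemma eq_cvg_series u v l : u =1 v ->
  series u @ \oo --> l -> series v @ \oo --> l.
Proof. by move=> /funext ->. Qed.

Lemma cvg_series0 u : u =1 (fun=> 0) -> series u @ \oo --> (0 : R).
Proof.
move=> /funext ->; rewrite (_ : series _ = fun=> 0); first exact: cvg_cst.
by apply/funext => n; rewrite seriesEnat/= big1.
Qed.

Lemma cvg_seriesMl a u l :
  series u @ \oo --> l -> series (fun n => a * u n) @ \oo --> a * l.
Proof.
move=> ul; rewrite (_ : series _ = fun n => a * series u n).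
  exact: cvgMl_tmp.
by apply/funext => n; rewrite !seriesEnat/= mulr_sumr.
Qed.

Lemma cvg_seriesMr a u l :
  series u @ \oo --> l -> series (fun n => u n * a) @ \oo --> l * a.
Proof.
move=> /(@cvg_seriesMl a); rewrite mulrC; apply: eq_cvg_series => n.
exact: mulrC.
Qed.

Lemma cvg_seriesB u v l s :
  series u @ \oo --> l -> series v @ \oo --> s ->
  series (fun n => u n - v n) @ \oo --> l - s.
Proof.
move=> ul vs; rewrite (_ : series _ = fun n => series u n - series v n).
  exact: cvgB.
by apply/funext => n; rewrite !seriesEnat/= sumrB.
Qed.

Lemma nneseries_EFin u l : (forall n, 0 <= u n) ->
  (series u @ \oo --> l) <-> (\sum_(n <oo) (u n)%:E)%E = l%:E.
Proof.
move=> u0.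
have sE : (fun n => \sum_(0 <= k < n) (u k)%:E)%E = EFin \o series u.
  by apply/funext => n /=; rewrite sumEFin.
rewrite sE; split=> [ul|ul].
  by rewrite EFin_lim ?(cvg_lim _ ul) //; exact: cvgP ul.
have cv : cvgn (EFin \o series u).
  by rewrite -sE; apply: is_cvg_nneseries => n _ _; rewrite lee_fin.
have : (EFin \o series u) @ \oo --> l%:E by rewrite -ul.
by move/fine_cvgP => -[].
Qed.

(** Tonelli in the extended reals: nonnegativity makes the two iterated sums equal there, so
    convergence of one transfers to the other. *)
Lemma series_interchange (f : nat -> nat -> R) (a b : nat -> R) s :
  (forall i j, 0 <= f i j) ->
  (forall i, series (f i) @ \oo --> a i) ->
  (forall j, series (f ^~ j) @ \oo --> b j) ->
  series a @ \oo --> s -> series b @ \oo --> s.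
Proof.
move=> f0 fa fb as_.
have ge0_lim (v : nat -> R) l : (forall n, 0 <= v n) ->
    series v @ \oo --> l -> 0 <= l.
  move=> v0 vl; rewrite -(cvg_lim _ vl)//; apply: limr_ge; first exact: cvgP vl.
  by apply: nearW => n; exact: sumr_ge0.
have a0 i : 0 <= a i by exact: (ge0_lim (f i)).
have b0 j : 0 <= b j by exact: (ge0_lim (f ^~ j)).
apply/nneseries_EFin => //.
rewrite -(proj1 (nneseries_EFin _ a0) as_).
under eq_eseriesr => j _ do
  rewrite -(proj1 (nneseries_EFin _ (fun i => f0 i j)) (fb j)).
under [RHS]eq_eseriesr => i _ do
  rewrite -(proj1 (nneseries_EFin _ (f0 i)) (fa i)).
by rewrite nneseries_interchange// => i j; rewrite lee_fin.
Qed.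

Lemma series_le_lim u l n :
  (forall n, 0 <= u n) -> series u @ \oo --> l -> series u n <= l.
Proof.
move=> u0 ul; rewrite -(cvg_lim _ ul)//.
apply: nondecreasing_cvgn_le; last exact: cvgP ul.
by apply: (nondecreasing_series (P := xpredT)).
Qed.

Lemma cvg_series_behead u l : series u @ \oo --> l -> u 0%N = 0 ->
  series (fun n => u n.+1) @ \oo --> l.
Proof.
rewrite -(cvg_shiftS (series u)) => + u0.
suff -> : [sequence series u n.+1]_n = series (fun n => u n.+1) by [].
by apply/funext => n /=; rewrite !seriesEnat /= big_nat_recl//= u0 add0r.
Qed.

Lemma cvg_series_cons u l : u 0%N = 0 ->
  series (fun n => u n.+1) @ \oo --> l -> series u @ \oo --> l.
Proof.
rewrite -(cvg_shiftS (series u)) => u0.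
suff -> : [sequence series u n.+1]_n = series (fun n => u n.+1) by [].
by apply/funext => n /=; rewrite !seriesEnat /= big_nat_recl//= u0 add0r.
Qed.

(** A form of Kronecker's lemma. Past [K] the tail of the convergent series is at most [e / 2], and
    it dominates because [c n <= c k] for [k < n]; the fixed head [series w K] is killed by
    [c n]. *)
Lemma kronecker w c : (forall n, 0 <= w n) ->
  (forall n, 0 <= c n) -> {homo c : m n / (m <= n)%N >-> n <= m} ->
  c @ \oo --> 0 -> cvgn (series (fun n => w n * c n)) ->
  (fun n => series w n * c n) @ \oo --> 0.
Proof.
move=> w0 c0 c_noninc cc /cvg_ex[/= s ws].
have wc0 n : 0 <= w n * c n by rewrite mulr_ge0.
apply/cvgr0Pnorm_le => e e0.
have [K _ HK] : \forall n \near \oo, s - e / 2 <= series (fun n => w n * c n) n.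
  move/cvgrPdist_le : ws => /(_ (e / 2)); rewrite divr_gt0// => /(_ isT).
  by apply: filterS => n; rewrite ler_norml => /andP[_]; lra.
have wK0 : 0 <= series w K by exact: sumr_ge0.
(* The [+ 1] keeps the divisor positive when [series w K] is zero. *)
have e' : 0 < e / 2 / (series w K + 1) by rewrite !divr_gt0// ltr_wpDl.
move/cvgr0Pnorm_le : cc => /(_ _ e') cc.
near=> n.
have Kn : (K <= n)%N by near: n; exists K.
rewrite ger0_norm ?mulr_ge0 ?sumr_ge0//.
have -> : series w n = series w K + \sum_(K <= k < n) w k.
  by rewrite -sub_series_geq// addrC subrK.
rewrite mulrDl (_ : e = e / 2 + e / 2); last by lra.
apply: lerD.
  have cn : c n <= e / 2 / (series w K + 1).
    by rewrite -[c n]ger0_norm//; near: n.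
  apply: (le_trans (y := (series w K + 1) * c n)).
    by rewrite ler_wpM2r// lerDl.
  by rewrite mulrC -ler_pdivlMr// ltr_wpDl.
rewrite mulr_suml.
apply: (le_trans (y := \sum_(K <= k < n) w k * c k)).
  rewrite !big_nat; apply: ler_sum => k /andP[_ kn].
  by rewrite ler_wpM2l// c_noninc// ltnW.
rewrite -(sub_series_geq (fun n => w n * c n))//.
have := series_le_lim n wc0 ws; have := HK K (leqnn K) => /=; lra.
Unshelve. all: by end_near.
Qed.

(** Summation by parts; the boundary term [series w n * c n] vanishes by [kronecker]. *)
Lemma abel_series w c s : (forall n, 0 <= w n) ->
  (forall n, 0 <= c n) -> {homo c : m n / (m <= n)%N >-> n <= m} ->
  c @ \oo --> 0 -> series (fun n => w n * c n) @ \oo --> s ->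
  series (fun n => series w n.+1 * (c n - c n.+1)) @ \oo --> s.
Proof.
move=> w0 c0 c_noninc cc ws.
have k0 := kronecker w0 c0 c_noninc cc (cvgP _ ws).
suff -> : series (fun n => series w n.+1 * (c n - c n.+1)) =
    (fun n => series (fun n => w n * c n) n - series w n * c n).
  by rewrite -[s]subr0; exact: cvgB.
apply/funext; elim=> [|n IH]; first by rewrite /series/= !big_nil; ring.
by rewrite seriesSr IH !seriesSr; ring.
Qed.

Lemma cvg_telescope_tail (f : nat -> R) n l : f @ \oo --> l ->
  series (fun k => if (n < k)%N then f k.-1 - f k else 0) @ \oo --> f n - l.
Proof.
move=> fl.
(* The partial sum below [k] ends with the term [k.-1]; [maxn] covers the range where every term is
   still zero. *)
suff -> : series (fun k => if (n < k)%N then f k.-1 - f k else 0) =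
    (fun k => f n - f (maxn n k.-1)).
  apply: cvgB; first exact: cvg_cst.
  rewrite -cvg_shiftS/=; apply: cvg_trans fl; apply: near_eq_cvg.
  by exists n => // k /= nk; rewrite (maxn_idPr nk).
apply/funext; elim=> [|k IH].
  by rewrite /series/= big_nil maxn0 subrr.
rewrite seriesSr IH /=; case: ltnP => nk.
  have -> : maxn n k.-1 = k.-1 by lia.
  by ring.
have -> : maxn n k.-1 = n by lia.
by ring.
Qed.

End series_lemmas.
Arguments cvg_seriesMl {R} a {u l} _.
Arguments cvg_seriesMr {R} a {u l} _.

Arguments cvg_telescope_tail {R f} n {l} _.

(** * The connector *)

Section connector.
Variable R : realType.

Definition conn (n b : nat) : R := ('C(n + b, n)%:R)^-1.

Lemma conn_gt0 n b : 0 < conn n b.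
Proof. by rewrite invr_gt0 ltr0n bin_gt0 leq_addr. Qed.

Lemma conn_ge0 n b : 0 <= conn n b.
Proof. exact: ltW (conn_gt0 n b). Qed.

Lemma conn_sym n b : conn n b = conn b n.
Proof. by rewrite /conn addnC -(bin_sub (leq_addl b n)) addnK. Qed.

Lemma conn0n b : conn 0 b = 1. Proof. by rewrite /conn bin0 invr1. Qed.

Lemma connn0 n : conn n 0 = 1. Proof. by rewrite conn_sym conn0n. Qed.

Lemma conn_Sr n b : conn n b.+1 = conn n b * (b.+1%:R / (n + b).+1%:R).
Proof.
have := mul_bin_down (n + b).+1 n; rewrite succnK.
rewrite (_ : (n + b).+1 - n = b.+1)%N; last by lia.
move=> /(congr1 (fun k => k%:R : R)); rewrite /conn addnS !natrM => E.
have C1 : 'C(n + b, n)%:R != 0 :> R.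
  by rewrite pnatr_eq0 -lt0n bin_gt0 leq_addr.
have C2 : 'C((n + b).+1, n)%:R != 0 :> R.
  by rewrite pnatr_eq0 -lt0n bin_gt0; lia.
have N : (n + b).+1%:R != 0 :> R by rewrite pnatr_eq0.
apply: (mulfI C1); apply: (mulfI C2); apply: (mulfI N).
transitivity ((n + b).+1%:R * 'C(n + b, n)%:R : R).
  by field; rewrite ?C1 ?C2.
by rewrite E; field; rewrite C1 -natrD nat1r N.
Qed.

Lemma conn_Sl n b : conn n.+1 b = conn n b * (n.+1%:R / (n + b).+1%:R).
Proof. by rewrite conn_sym conn_Sr conn_sym addnC. Qed.

Lemma connB n b : conn n b - conn n b.+1 = n%:R * (conn n b.+1 / b.+1%:R).
Proof.
rewrite conn_Sr -addnS natrD; field.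
by rewrite nat1r -natrD addnS !pnatr_eq0.
Qed.

Lemma conn_noninc n : {homo conn n : a b / (a <= b)%N >-> b <= a}.
Proof.
apply: homo_leq => [x//|x y z xy yz|b]; first exact: le_trans yz xy.
by rewrite -subr_ge0 connB !mulr_ge0 ?divr_ge0 ?conn_ge0.
Qed.

(** For [n >= 1] the binomial is at least [b + 1], by Pascal's rule starting from [n = 1]. *)
Lemma cvg_conn n : (0 < n)%N -> conn n @ \oo --> 0.
Proof.
move=> n0.
apply: (@squeeze_cvgr _ _ _ _ (fun=> 0) harmonic); last exact: cvg_harmonic.
  apply: nearW => b; rewrite conn_ge0/= /conn lef_pV2 ?posrE ?ltr0n ?bin_gt0 ?leq_addr//.
  rewrite ler_nat; case: n n0 => // n _.
  elim: n => [|n IH]; first by rewrite add1n bin1.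
  apply: leq_trans IH _.
  by rewrite [in leqRHS]addSn binS leq_addl.
exact: cvg_cst.
Qed.

(* The transport relation of the connected sum method, in summed form: it
   trades a factor [1 / n] for one more summation on the side of [b]. *)
Lemma series_conn_transport (n : nat) (w : nat -> R) (s : R) : (0 < n)%N ->
  (forall b, 0 <= w b) -> series (fun b => w b * conn n b) @ \oo --> s ->
  series (fun b => series w b / b%:R * conn n b) @ \oo --> s / n%:R.
Proof.
move=> n0 w0 ws.
have n0R : n%:R != 0 :> R by rewrite pnatr_eq0 -lt0n.
have := abel_series w0 (conn_ge0 n) (@conn_noninc n) (cvg_conn n0) ws.
move=> /(cvg_seriesMr n%:R^-1) h.
apply: cvg_series_cons; first by rewrite /series/= big_nil !mul0r.
apply: eq_cvg_series h => b /=.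
by rewrite connB; field; rewrite n0R nat1r pnatr_eq0.
Qed.

(** Transport of the unit mass at [b = 0]: its connected sum is [conn n 0 = 1], and its partial sums
    equal 1 from [b = 1] on. *)
Lemma series_conn_inv n : (0 < n)%N ->
  series (fun b => conn n b / b%:R) @ \oo --> (n%:R^-1 : R).
Proof.
move=> n0.
have := @series_conn_transport n (fun b => (b == 0)%:R) 1 n0 (fun b => ler0n _ _).
rewrite mul1r => h.
have cs : series (fun b => (b == 0)%:R * conn n b) @ \oo --> (1 : R).
  rewrite -cvg_shiftS/= (_ : (fun k => _) = fun=> 1); first exact: cvg_cst.
  apply/funext => k /=; rewrite seriesEnat/= big_nat_recl//= connn0 mulr1.
  by rewrite big1 ?addr0// => i _; rewrite mul0r.
apply: eq_cvg_series (h cs) => -[|b]; first by rewrite invr0 !mulr0 mul0r.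
rewrite (_ : series _ b.+1 = 1); first by rewrite mul1r mulrC.
by rewrite seriesEnat/= big_nat_recl//= big1 ?addr0.
Qed.

(** By symmetry of the connector, [connB] makes [conn k b / k] a difference in [k] divided by [b],
    so the tail telescopes. *)
Lemma series_conn_tail n b : (0 < b)%N ->
  series (fun k => if (n < k)%N then conn k b / k%:R else 0) @ \oo
    --> conn n b / b%:R.
Proof.
move=> b0.
have b0R : b%:R != 0 :> R by rewrite pnatr_eq0 -lt0n.
have := cvg_telescope_tail n (cvg_conn b0).
rewrite subr0 conn_sym => /(cvg_seriesMr b%:R^-1).
apply: eq_cvg_series => -[|k] /=; first by rewrite mul0r.
case: ltnP => _; last by rewrite mul0r.
by rewrite connB [conn k.+1 b]conn_sym; field; rewrite b0R nat1r pnatr_eq0.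
Qed.

End connector.

(** * Tails of the alternating harmonic series *)

Section alternating.
Variable R : realType.

(** Consecutive terms of 1 - 1/2 + 1/3 - ... (that is, log 2) are paired, so that the series has
    nonnegative terms. *)
Definition alt_term (i : nat) : R := (2 * i + 1)%:R^-1 - (2 * i + 2)%:R^-1.

Definition alt_sum : R := limn (series alt_term).

(* The index is shifted: this is [tau_(b+1)] of the header. *)
Definition alt_tail (b : nat) : R := alt_sum - series alt_term b.

Lemma alt_termE i : alt_term i = ((2 * i + 1)%:R * (2 * i + 2)%:R)^-1.
Proof.
rewrite /alt_term !(natrD, natrM).
have i0 : 0 <= i%:R :> R by [].
by field; repeat (apply/andP; split); lra.
Qed.

Lemma alt_term_ge0 i : 0 <= alt_term i.
Proof. by rewrite alt_termE invr_ge0 mulr_ge0. Qed.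

(** The alternating partial sums with [2n + 1] terms, which decrease to the limit. *)
Let upper n : R := series alt_term n + (2 * n + 1)%:R^-1.

Let upper_noninc : nonincreasing_seq upper.
Proof.
apply/nonincreasing_seqP => n; rewrite /upper seriesSr/= /alt_term.
rewrite -subr_ge0 (_ : _ - _ = (2 * n + 2)%:R^-1 - (2 * n.+1 + 1)%:R^-1); last by ring.
by rewrite subr_ge0 lef_pV2 ?posrE ?ltr0n ?ler_nat; lia.
Qed.

Lemma is_cvg_alt_series : series alt_term @ \oo --> alt_sum.
Proof.
apply: nondecreasing_is_cvgn.
  by apply: (nondecreasing_series (P := xpredT)) => n _ _; exact: alt_term_ge0.
exists 1 => _ [n _ <-]; apply: le_trans (_ : upper n <= 1).
  by rewrite lerDl.
apply: le_trans (upper_noninc (leq0n n)) _.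
by rewrite /upper seriesEnat/= big_geq// add0r invr1.
Qed.

Lemma cvg_odd_inv : (fun n => (2 * n + 1)%:R^-1 : R) @ \oo --> 0.
Proof.
apply: (@squeeze_cvgr _ _ _ _ (fun=> 0) harmonic); last exact: cvg_harmonic.
  apply: nearW => n; rewrite invr_ge0 ler0n/= /harmonic/=.
  by rewrite lef_pV2 ?posrE ?ltr0n ?ler_nat; lia.
exact: cvg_cst.
Qed.

Lemma alt_tail_le b : alt_tail b <= (2 * b + 1)%:R^-1.
Proof.
rewrite lerBlDl.
have ul : upper @ \oo --> alt_sum.
  by rewrite -[alt_sum]addr0; apply: cvgD; [exact: is_cvg_alt_series|exact: cvg_odd_inv].
have := nonincreasing_cvgn_ge upper_noninc (cvgP _ ul) b.
by rewrite (cvg_lim _ ul).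
Qed.

(** Half of the next term is added to the partial sum; convexity of 1/x makes the result increase to
    the limit. *)
Lemma alt_tail_ge b : (2 * b + 1)%:R^-1 / 2 <= alt_tail b.
Proof.
rewrite lerBrDl.
pose lower n : R := series alt_term n + (2 * n + 1)%:R^-1 / 2.
have lower_nondec : nondecreasing_seq lower.
  apply/nondecreasing_seqP => n; rewrite /lower seriesSr/= /alt_term.
  rewrite !(natrD, natrM) -[n.+1%:R]natr1.
  have n0 : 0 <= n%:R :> R by [].
  move: (n%:R) n0 => x x0; rewrite -subr_ge0.
  rewrite (_ : _ - _ = ((2 * x + 1) * (2 * x + 2) * (2 * x + 3))^-1).
    by rewrite invr_ge0 !mulr_ge0//; lra.
  by field; repeat (apply/andP; split); lra.
have ll : lower @ \oo --> alt_sum.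
  rewrite -[alt_sum]addr0; apply: cvgD; first exact: is_cvg_alt_series.
  by rewrite -(mul0r (2^-1)); apply: cvgMr_tmp; exact: cvg_odd_inv.
have := nondecreasing_cvgn_le lower_nondec (cvgP _ ll) b.
by rewrite (cvg_lim _ ll).
Qed.

Lemma alt_tail_ge0 b : 0 <= alt_tail b.
Proof. by apply: le_trans (alt_tail_ge b); rewrite divr_ge0. Qed.

Lemma cvg_alt_tail : alt_tail @ \oo --> 0.
Proof.
by rewrite -(subrr alt_sum); apply: cvgB; [exact: cvg_cst|exact: is_cvg_alt_series].
Qed.

Lemma alt_tailB b : alt_tail b - alt_tail b.+1 = alt_term b.
Proof. by rewrite /alt_tail seriesSr; ring. Qed.

Lemma is_cvg_alt_tail_odd :
  cvgn (series (fun c => 4 * alt_tail c / (2 * c + 1)%:R)).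
Proof.
(* By [alt_tail_le] the term is at most [4 / (2c+1)^2], and [2c + 2 <= 2(2c + 1)] turns this into
   [8 * alt_term c]. *)
apply: (series_le_cvg (v_ := fun c => 8 * alt_term c)).
- by move=> c; rewrite divr_ge0// mulr_ge0// alt_tail_ge0.
- by move=> c; rewrite mulr_ge0// alt_term_ge0.
- move=> c; rewrite alt_termE.
  have cp : 0 < (2 * c + 1)%:R :> R by rewrite ltr0n; lia.
  rewrite ler_pdivrMr//.
  apply: (le_trans (y := 4 * (2 * c + 1)%:R^-1)).
    by rewrite ler_wpM2l// alt_tail_le.
  rewrite (_ : 2 * c + 2 = (2 * c + 1).+1)%N; last by lia.
  have : 1 <= (2 * c + 1)%:R :> R by rewrite ler1n; lia.
  rewrite -[(2 * c + 1).+1%:R]natr1; move: ((2 * c + 1)%:R) cp => x x0 x1; rewrite -subr_ge0.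
  rewrite (_ : _ - _ = 4 * (x - 1) / (x * (x + 1))).
    by rewrite divr_ge0 ?mulr_ge0//; lra.
  by field; apply/andP; split; lra.
- exact: cvgP (cvg_seriesMl 8 is_cvg_alt_series).
Qed.

Lemma sign_odd b : (-1) ^+ (2 * b + 1) = -1 :> R.
Proof. by rewrite -signr_odd oddD oddM. Qed.

Lemma sign_even b : (-1) ^+ (2 * b + 2) = 1 :> R.
Proof. by rewrite -signr_odd oddD oddM. Qed.

(** The term [n = 0] is zero since [0^-1 = 0]. The limit is [- alt_sum], so [alt_harm M + alt_sum]
    is the tail of 1 - 1/2 + 1/3 - ... from [n = M] on. *)
Definition alt_harm (M : nat) : R := series (fun n => (-1) ^+ n / n%:R) M.

Lemma alt_harm_odd b : alt_harm (2 * b + 1) = - series alt_term b.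
Proof.
elim: b => [|b IH].
  rewrite muln0 add0n /alt_harm seriesSr !seriesEnat/= !big_geq//.
  by rewrite invr0 mulr0 addr0 oppr0.
rewrite seriesSr opprD -IH /alt_harm (_ : 2 * b.+1 + 1 = (2 * b + 1).+2)%N; last by lia.
rewrite !seriesSr /alt_term (_ : (2 * b + 1).+1 = 2 * b + 2)%N; last by lia.
by rewrite sign_odd sign_even; ring.
Qed.

Lemma alt_harm_tail b : alt_harm (2 * b + 1) + alt_sum = alt_tail b.
Proof. by rewrite alt_harm_odd addrC. Qed.

Lemma alt_harm_even_tail b :
  alt_harm (2 * b + 2) + alt_sum = alt_tail b - (2 * b + 1)%:R^-1.
Proof.
rewrite -alt_harm_tail /alt_harm (_ : 2 * b + 2 = (2 * b + 1).+1)%N; last by lia.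
by rewrite seriesSr sign_odd; ring.
Qed.

(** Controls the boundary term when the leading [bar_ 1] is summed by parts; [M.+1] matches
    [harmonic M]. *)
Lemma alt_harm_approx M : `|alt_harm M + alt_sum| <= 2 / M.+1%:R.
Proof.
have [b [->|[->|->]]] : exists b, M = 0%N \/ M = (2 * b + 1)%N \/ M = (2 * b + 2)%N.
- exists (M.-1./2); lia.
- rewrite /alt_harm seriesEnat/= big_geq// add0r -[alt_sum]subr0.
  have := alt_tail_le 0; have := alt_tail_ge0 0.
  rewrite /alt_tail seriesEnat/= big_geq// => h0 h1; rewrite ger0_norm//.
  by move: h1; rewrite invr1; lra.
- rewrite alt_harm_tail ger0_norm ?alt_tail_ge0//.
  apply: le_trans (alt_tail_le b) _.
  rewrite ler_pdivlMr ?ltr0n// mulrC ler_pdivrMr ?ltr0n ?addn1//.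
  by rewrite -natrM ler_nat; lia.
- rewrite alt_harm_even_tail distrC.
  have h := alt_tail_ge b; have h' := alt_tail_le b.
  rewrite ger0_norm ?subr_ge0//.
  apply: (le_trans (y := (2 * b + 1)%:R^-1 / 2)); first by lra.
  rewrite -invfM ler_pdivlMr ?ltr0n// mulrC ler_pdivrMr; last first.
    by rewrite mulr_gt0// ltr0n; lia.
  by rewrite -!natrM ler_nat; lia.
Qed.

End alternating.

(** * Central binomial sums *)

Section central_binomial.
Variable R : realType.

Definition cbin (n : nat) : R := 'C(2 * n, n)%:R / 4 ^+ n.

Lemma cbinE n : cbin n = (conn R n n)^-1 / 4 ^+ n.
Proof. by rewrite /cbin /conn invrK addnn mul2n. Qed.

Lemma cbin_ge0 n : 0 <= cbin n.
Proof. by rewrite divr_ge0// exprn_ge0. Qed.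

Lemma cbinS n : cbin n.+1 = cbin n * ((2 * n + 1)%:R / (2 * n + 2)%:R).
Proof.
rewrite !cbinE conn_Sr conn_Sl.
have := lt0r_neq0 (conn_gt0 R n n).
move: (conn R n n) => x x0.
have p0 : 4 ^+ n != 0 :> R by rewrite expf_neq0.
rewrite exprS addSn -[(n + n).+2%:R]natr1 -[(n + n).+1%:R]natr1 -[n.+1%:R]natr1.
rewrite !(natrD, natrM).
have n0 : 0 <= n%:R :> R by [].
field; rewrite x0 p0/=; repeat (apply/andP; split); lra.
Qed.

(** Squaring keeps the induction rational: the step amounts to [(2n+1)(2n+3) <= (2n+2)^2]. *)
Lemma cbin_sqr_le n : cbin n ^+ 2 <= (2 * n + 1)%:R^-1.
Proof.
elim: n => [|n IH]; first by rewrite /cbin muln0 bin0 expr0 divr1 expr1n invr1.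
rewrite cbinS exprMn; apply: le_trans (ler_wpM2r (sqr_ge0 _) IH) _.
rewrite !(natrD, natrM) -[n.+1%:R]natr1.
have n0 : 0 <= n%:R :> R by [].
move: (n%:R) n0 => x x0; rewrite -subr_ge0.
rewrite (_ : _ - _ = ((2 * x + 2) ^+ 2 * (2 * x + 3))^-1).
  by rewrite invr_ge0 mulr_ge0 ?sqr_ge0//; lra.
by field; repeat (apply/andP; split); lra.
Qed.

Lemma cvg_cbin : cbin @ \oo --> 0.
Proof.
apply/cvgr0Pnorm_le => e e0.
have e20 : 0 < e ^+ 2 by rewrite exprn_gt0.
have /cvgr0Pnorm_le/(_ _ e20) := @cvg_odd_inv R; apply: filterS => n.
rewrite !ger0_norm ?cbin_ge0 ?invr_ge0// => h.
rewrite -(ler_pXn2r (n := 2))// ?nnegrE ?cbin_ge0 ?(ltW e0)//.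
exact: le_trans (cbin_sqr_le n) h.
Qed.

(** A hypergeometric antidifference in [j], up to sign, of [cbin j * conn R j c.+1], as [TB]
    checks. *)
Let T (c j : nat) : R := cbin j * conn R j c * ((2 * c + 2)%:R / (2 * c + 1)%:R).

Let TB c j : T c j - T c j.+1 = cbin j * conn R j c.+1.
Proof.
rewrite /T cbinS conn_Sr conn_Sl.
rewrite -?[c.+1%:R]natr1 -?[j.+1%:R]natr1 -?[(j + c).+1%:R]natr1 !(natrD, natrM).
have j0 : 0 <= j%:R :> R by [].
have c0 : 0 <= c%:R :> R by [].
field; repeat (apply/andP; split); lra.
Qed.

Let T_ge0 c j : 0 <= T c j.
Proof. by rewrite /T !mulr_ge0 ?cbin_ge0 ?conn_ge0// invr_ge0. Qed.

Let T_noninc c : {homo T c : a b / (a <= b)%N >-> b <= a}.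
Proof.
apply: homo_leq => [x//|x y z xy yz|b]; first exact: le_trans yz xy.
by rewrite -subr_ge0 TB mulr_ge0 ?cbin_ge0 ?conn_ge0.
Qed.

Let cvg_T c : T c @ \oo --> 0.
Proof.
rewrite -(mul0r ((2 * c + 2)%:R / (2 * c + 1)%:R : R)); apply: cvgMr_tmp.
apply: (@squeeze_cvgr _ _ _ _ (fun=> 0) cbin); [|exact: cvg_cst|exact: cvg_cbin].
apply: nearW => n; rewrite mulr_ge0 ?cbin_ge0 ?conn_ge0//=.
rewrite ler_piMr ?cbin_ge0//.
by have := @conn_noninc R n 0%N c (leq0n c); rewrite connn0.
Qed.

Let series_cbin_connS c :
  series (fun j => cbin j.+1 * conn R j.+1 c.+1) @ \oo --> ((2 * c + 1)%:R^-1 : R).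
Proof.
have h := cvg_telescope_tail 1 (cvg_T c).
have -> : (2 * c + 1)%:R^-1 = T c 1 - 0.
  rewrite subr0 /T cbinS /cbin muln0 bin0 expr0 conn_Sl conn0n add0n.
  rewrite -?[c.+1%:R]natr1 !(natrD, natrM).
  have c0 : 0 <= c%:R :> R by [].
  by field; repeat (apply/andP; split); lra.
(* The terms of index 0 and 1 are zero; dropping them moves the telescope to the pairs [j + 1],
   [j + 2]. *)
have {}h := cvg_series_behead (cvg_series_behead h erefl) erefl.
by apply: eq_cvg_series h => j /=; rewrite TB.
Qed.

(** Expand [conn j b / j] as the sum of [conn j k / k] over [k > b] and interchange: summing over
    [j] leaves [1 / ((2k-1) k) = 2 * alt_term k.-1]. *)
Lemma series_cbin_conn_inv b :
  series (fun j => cbin j * conn R j b / j%:R) @ \oo --> 2 * alt_tail R b.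
Proof.
apply: cvg_series_cons; first by rewrite /= invr0 mulr0.
pose f (k j : nat) : R := if (b < k)%N then cbin j.+1 * (conn R j.+1 k / k%:R) else 0.
pose a (k : nat) : R := if (b < k)%N then 2 * alt_term R k.-1 else 0.
apply: (@series_interchange _ f a).
- move=> k j; rewrite /f; case: ifP => // _.
  by rewrite mulr_ge0 ?cbin_ge0// divr_ge0// conn_ge0.
- move=> k; rewrite /f /a; case: ltnP => bk; last first.
    exact: cvg_series0.
  case: k bk => // k _ /=.
  have := cvg_seriesMr k.+1%:R^-1 (@series_cbin_connS k).
  have -> : (2 * k + 1)%:R^-1 / k.+1%:R = 2 * alt_term R k.
    rewrite alt_termE -[k.+1%:R]natr1 !(natrD, natrM).
    have k0 : 0 <= k%:R :> R by [].
    by field; repeat (apply/andP; split); lra.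
  by apply: eq_cvg_series => j; rewrite mulrA.
- move=> j; have := cvg_seriesMl (cbin j.+1) (@series_conn_tail R b j.+1 isT).
  rewrite /= mulrA [conn R b _]conn_sym.
  by apply: eq_cvg_series => k; rewrite /f conn_sym; case: ifP => // _; rewrite mulr0.
- have := cvg_seriesMl 2 (cvg_telescope_tail b (@cvg_alt_tail R)).
  rewrite subr0; apply: eq_cvg_series => -[|k]; first by rewrite /a mulr0.
  by rewrite /a; case: ifP => _; rewrite ?mulr0//= alt_tailB.
Qed.

Lemma gharm1E n : gharm R 1 n = series (fun k => k%:R^-1) n.+1.
Proof.
rewrite /gharm seriesEnat/= [RHS]big_nat_recl//= invr0 add0r big_add1/=.
by apply: eq_bigr => k _; rewrite expr1.
Qed.

Lemma gharm_ge0 s n : 0 <= gharm R s n.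
Proof. by apply: sumr_ge0 => k _; rewrite invr_ge0 exprn_ge0. Qed.

(** Summation by parts with weights [1 / n], whose partial sums are harmonic numbers, against [T c],
    whose differences are given by [TB]. *)
Lemma series_harm_cbin_conn c :
  series (fun n => gharm R 1 n * cbin n * (conn R n c.+1 / c.+1%:R)) @ \oo
    --> 4 * alt_tail R c / (2 * c + 1)%:R.
Proof.
have h := cvg_seriesMr ((2 * c + 2)%:R / (2 * c + 1)%:R) (@series_cbin_conn_inv c).
have wT : series (fun n => n%:R^-1 * T c n) @ \oo -->
    2 * alt_tail R c * ((2 * c + 2)%:R / (2 * c + 1)%:R).
  by apply: eq_cvg_series h => n; rewrite /T; ring.
have w0 n : 0 <= n%:R^-1 :> R by rewrite invr_ge0.
have := abel_series w0 (T_ge0 c) (@T_noninc c) (cvg_T c) wT.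
move=> /(cvg_seriesMr c.+1%:R^-1).
have -> : 2 * alt_tail R c * ((2 * c + 2)%:R / (2 * c + 1)%:R) / c.+1%:R =
    4 * alt_tail R c / (2 * c + 1)%:R.
  rewrite -[c.+1%:R]natr1 !(natrD, natrM).
  have c0 : 0 <= c%:R :> R by [].
  by field; repeat (apply/andP; split); lra.
by apply: eq_cvg_series => n; rewrite TB gharm1E !mulrA.
Qed.

(** Expand [1 / n] by [series_conn_inv] and interchange; the sums over [n] are then the summable
    [4 * alt_tail c / (2c + 1)]. *)
Lemma is_cvg_harm_cbin_inv :
  cvgn (series (fun n => gharm R 1 n * cbin n / n%:R)).
Proof.
have /cvg_ex[/= s hs] := @is_cvg_alt_tail_odd R.
apply/cvg_ex; exists s.
pose f (c n : nat) := gharm R 1 n * cbin n * (conn R n c.+1 / c.+1%:R).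
apply: (@series_interchange _ f _ _ _ _ series_harm_cbin_conn _ hs).
  move=> c n; apply: mulr_ge0; first by rewrite mulr_ge0 ?gharm_ge0 ?cbin_ge0.
  by rewrite divr_ge0// conn_ge0.
move=> [|n].
  rewrite /f /gharm big_geq// !mul0r; apply: cvg_series0 => c.
  by rewrite !mul0r.
have h := cvg_series_behead (@series_conn_inv R n.+1 isT).
have z : conn R n.+1 0 / 0%:R = 0 by rewrite /= invr0 mulr0.
exact: cvg_seriesMl (h z).
Qed.

End central_binomial.

(** * Transport to nested sums over even indices *)

Section transport.
Variable R : realType.

Lemma deco_coef_ge0 d n : ~~ (if d is Bar then true else false) ->
  0 <= deco_coef R d n.
Proof.
by case: d => //= _; rewrite -signr_odd; case: odd; rewrite ?expr1 ?expr0; lra.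
Qed.

Definition no_bar (s : seq mzv_entry) : bool :=
  all (fun e => ~~ (if e.2 is Bar then true else false)) s.

Lemma mmzv_trunc_ge0 s N : no_bar s -> 0 <= mmzv_trunc R s N.
Proof.
elim: s N => [|[k d] s IH] N /=; first by rewrite ler01.
move=> /andP[dP sP]; apply: sumr_ge0 => n _.
by rewrite mulr_ge0 ?IH// divr_ge0 ?exprn_ge0 ?deco_coef_ge0.
Qed.

(** The positive exponent makes the extra term [n = 0] of [series] vanish, by [0^-1 = 0]. *)
Lemma mmzv_truncE k d s N :
  mmzv_trunc R ((k.+1, d) :: s) N =
  series (fun n => deco_coef R d n / n%:R ^+ k.+1 * mmzv_trunc R s n) N.
Proof.
case: N => [|N]; first by rewrite seriesEnat/= !big_geq.
rewrite seriesEnat /= [RHS]big_nat_recl//= expr0n/= invr0 mulr0 mul0r add0r.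
by rewrite big_add1.
Qed.

Lemma series_double (u : nat -> R) b :
  series u (2 * b)%N = series (fun j => u (2 * j)%N + u (2 * j + 1)%N) b.
Proof.
elim: b => [|b IH]; first by rewrite !seriesEnat/= !big_geq.
rewrite (_ : 2 * b.+1 = (2 * b).+2)%N; last by lia.
by rewrite !seriesSr IH addn1 addrA.
Qed.

Lemma deco_hat_odd j : deco_coef R Hat (2 * j + 1) = 0.
Proof. by rewrite /= sign_odd; ring. Qed.

Lemma deco_tilde_odd j : deco_coef R Tilde (2 * j + 1) = 2.
Proof. by rewrite /= sign_odd; ring. Qed.

Lemma deco_hat_even j : deco_coef R Hat (2 * j) = 2.
Proof. by rewrite /= -signr_odd oddM/= expr0. Qed.

Lemma deco_tilde_even j : deco_coef R Tilde (2 * j) = 0.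
Proof. by rewrite /= -signr_odd oddM/= expr0 subrr. Qed.

Lemma mmzv_trunc_hat k s b :
  mmzv_trunc R (hat_ k.+1 :: s) (2 * b) =
  series (fun j => 2 / (2 * j)%:R ^+ k.+1 * mmzv_trunc R s (2 * j)) b.
Proof.
rewrite mmzv_truncE series_double; congr (series _ b); apply/funext => j.
by rewrite deco_hat_even deco_hat_odd !mul0r addr0.
Qed.

(** Converts the bound at an odd leading index into the even bounds produced by transport. *)
Lemma mmzv_trunc_hat_odd k s b :
  mmzv_trunc R (hat_ k.+1 :: s) (2 * b + 1) =
  mmzv_trunc R (hat_ k.+1 :: s) (2 * b.+1).
Proof.
rewrite !mmzv_truncE (_ : 2 * b.+1 = (2 * b + 1).+1)%N; last by lia.
by rewrite [RHS]seriesSr deco_hat_odd !mul0r addr0.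
Qed.

(** The coefficient 2 cancels against the even index [2j]: a [hat_ 1] is a plain 1 on halved
    indices. *)
Lemma mmzv_trunc_hat1 s b :
  mmzv_trunc R (hat_ 1 :: s) (2 * b) =
  series (fun j => mmzv_trunc R s (2 * j) / j%:R) b.
Proof.
rewrite mmzv_trunc_hat; congr (series _ b); apply/funext => j.
by rewrite natrM expr1 invfM mulrA divff// mul1r mulrC.
Qed.

(** Here only one of the two factors 2 in [(2j)^2] cancels, whence the 2 on the left. *)
Lemma mmzv_trunc_hat2 s b :
  2 * mmzv_trunc R (hat_ 2 :: s) (2 * b) =
  series (fun j => mmzv_trunc R s (2 * j) / j%:R / j%:R) b.
Proof.
rewrite mmzv_trunc_hat !seriesEnat/= mulr_sumr; apply: eq_bigr => j _.
by rewrite natrM -exprVn invfM; move: (j%:R^-1) => x; field.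
Qed.

(** Starting from [series_conn_inv], each transport divides by [k] and adds one [hat_ 1]. *)
Lemma series_hats_conn q k : (0 < k)%N ->
  series (fun b => mmzv_trunc R (nseq q (hat_ 1)) (2 * b) / b%:R * conn R k b)
    @ \oo --> ((k%:R ^+ q.+1)^-1 : R).
Proof.
move=> k0; elim: q => [|q IH].
  rewrite expr1; apply: eq_cvg_series (@series_conn_inv R k k0) => b /=.
  by rewrite mul1r mulrC.
rewrite [k%:R ^+ q.+2]exprSr invfM.
have w0 b : 0 <= mmzv_trunc R (nseq q (hat_ 1)) (2 * b) / b%:R.
  by rewrite divr_ge0// mmzv_trunc_ge0// /no_bar all_nseq orbT.
apply: eq_cvg_series (series_conn_transport k0 w0 IH) => b.
by rewrite [nseq q.+1 _]/= mmzv_trunc_hat1.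
Qed.

Lemma zeta_truncE m :
  mmzv_trunc R [:: plain_ m.+1] = series (fun n => (n%:R ^+ m.+1)^-1 : R).
Proof.
apply/funext => N; rewrite mmzv_truncE; congr (series _ N).
by apply/funext => n; rewrite /= mul1r mulr1.
Qed.

Lemma is_cvg_zeta m : (1 <= m)%N ->
  series (fun n => (n%:R ^+ m.+1)^-1 : R) @ \oo --> zeta_nat R m.+1.
Proof.
move=> m1.
rewrite /zeta_nat /mmzv zeta_truncE.
(* Comparison for [n >= 1]: [1 / n^2 <= 2 (1/n - 1/(n+1))], since [n + 1 <= 2n]. *)
have h := cvg_seriesMl 2 (cvg_telescope_tail 0 (@cvg_harmonic R)).
apply: (series_le_cvg (v_ := _) _ _ _ (cvgP _ h)) => [n|[|n]|[|n]] /=.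
- by rewrite invr_ge0 exprn_ge0.
- by rewrite mulr0.
- rewrite mulr_ge0// subr_ge0 lef_pV2 ?posrE ?ltr0n// ler_nat; lia.
- by rewrite expr0n/= invr0 mulr0.
- apply: (le_trans (y := (n.+1%:R ^+ 2)^-1)).
    rewrite lef_pV2 ?posrE ?exprn_gt0 ?ltr0n//.
    by rewrite ler_weXn2l// ler1n.
  rewrite -[n.+2%:R]natr1.
  have : 1 <= n.+1%:R :> R by rewrite ler1n.
  move: (n.+1%:R) => x x1; rewrite -subr_ge0.
  rewrite (_ : _ - _ = (x - 1) / (x ^+ 2 * (x + 1))).
    by rewrite divr_ge0 ?mulr_ge0 ?exprn_ge0//; lra.
  by field; repeat (apply/andP; split); lra.
Qed.

Lemma series_zeta_tail m n : (1 <= m)%N ->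
  series (fun k => if (n < k)%N then (k%:R ^+ m.+1)^-1 else 0 : R) @ \oo
    --> zeta_nat R m.+1 - gharm R m.+1 n.
Proof.
move=> /is_cvg_zeta h.
pose f k := zeta_nat R m.+1 - series (fun n => (n%:R ^+ m.+1)^-1 : R) k.+1.
have fl : f @ \oo --> (0 : R).
  rewrite -(subrr (zeta_nat R m.+1)); apply: cvgB; first exact: cvg_cst.
  by rewrite (cvg_shiftS (series _)).
have -> : zeta_nat R m.+1 - gharm R m.+1 n = f n - 0.
  rewrite subr0 /f /gharm seriesEnat/= [in RHS]big_nat_recl//=.
  by rewrite expr0n/= invr0 add0r big_add1.
apply: eq_cvg_series (cvg_telescope_tail n fl) => -[|k] //=.
by case: ifP => // _; rewrite /f [series _ k.+2]seriesSr; ring.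
Qed.

(** Each [k^-(q+2)] with [k > n] is [1 / k] times a connected sum. After interchange, summing
    [conn k b / k] over [k > n] gives [conn n b / b]: this second [1 / b] is the origin of
    [hat_ 2]. *)
Lemma series_zeta_tail_conn q n :
  series (fun b => mmzv_trunc R (nseq q (hat_ 1)) (2 * b) / b%:R / b%:R
                   * conn R n b)
    @ \oo --> zeta_nat R q.+2 - gharm R q.+2 n.
Proof.
pose E b := mmzv_trunc R (nseq q (hat_ 1)) (2 * b).
have E0 b : 0 <= E b by rewrite mmzv_trunc_ge0// /no_bar all_nseq orbT.
pose f (k b : nat) := if (n < k)%N then E b / b%:R * conn R k b / k%:R else 0.
apply: (@series_interchange _ f _ _ _ _ _ _ (@series_zeta_tail q.+1 n isT)).
- move=> k b; rewrite /f; case: ifP => // _.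
  by rewrite divr_ge0// mulr_ge0 ?conn_ge0// divr_ge0.
- move=> k; rewrite /f; case: ltnP => nk; last exact: cvg_series0.
  rewrite exprSr invfM.
  by apply: cvg_seriesMr; apply: series_hats_conn; lia.
- case=> [|b]; rewrite /f.
    rewrite /= invr0 !(mulr0, mul0r); apply: cvg_series0 => k.
    by rewrite !(mulr0, mul0r); case: ifP.
  have := cvg_seriesMl (E b.+1 / b.+1%:R) (@series_conn_tail R n b.+1 isT).
  rewrite mulrA mulrAC => h; apply: eq_cvg_series h => k.
  by case: ifP => _; rewrite ?mulr0// mulrA.
Qed.

(** The block shared by both mixed values, with [r = p - 1] and [q = m - 1]. *)
Definition core (r q : nat) : seq mzv_entry :=
  nseq r (hat_ 1) ++ hat_ 2 :: nseq q (hat_ 1).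

Lemma no_bar_core r q : no_bar (core r q).
Proof. by rewrite /no_bar all_cat /= !all_nseq !orbT. Qed.

(** Transport applied [r.+1] times to the zeta tail: the first application creates [hat_ 2] and its
    factor 2, each later one a [hat_ 1]. *)
Lemma series_core_conn r q n : (0 < n)%N ->
  series (fun b => 2 * mmzv_trunc R (core r q) (2 * b) / b%:R * conn R n b)
    @ \oo --> (zeta_nat R q.+2 - gharm R q.+2 n) / n%:R ^+ r.+1.
Proof.
move=> n0; elim: r => [|r IH].
  have w0 b : 0 <= mmzv_trunc R (nseq q (hat_ 1)) (2 * b) / b%:R / b%:R.
    by rewrite !divr_ge0// mmzv_trunc_ge0// /no_bar all_nseq orbT.
  have := series_conn_transport n0 w0 (@series_zeta_tail_conn q n).
  by rewrite expr1; apply: eq_cvg_series => b; rewrite mmzv_trunc_hat2.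
have w0 b : 0 <= 2 * mmzv_trunc R (core r q) (2 * b) / b%:R.
  by rewrite divr_ge0// mulr_ge0// mmzv_trunc_ge0// no_bar_core.
have := series_conn_transport n0 w0 IH.
rewrite [n%:R ^+ r.+2]exprSr invfM mulrA; apply: eq_cvg_series => b.
rewrite [core r.+1 q]/= mmzv_trunc_hat1; congr (_ / _ * _).
by rewrite !seriesEnat/= mulr_sumr; apply: eq_bigr => j _; rewrite mulrA.
Qed.

(** Double sum over [n] and [b = c + 1]: summing over [b] first is [series_core_conn], over [n]
    first [series_harm_cbin_conn]. *)
Lemma series_core_alt_tail r q (l : R) :
  series (fun n => gharm R 1 n * cbin R n *
    ((zeta_nat R q.+2 - gharm R q.+2 n) / n%:R ^+ r.+1)) @ \oo --> l ->
  series (fun c => 2 * mmzv_trunc R (core r q) (2 * c.+1) *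
    (4 * alt_tail R c / (2 * c + 1)%:R)) @ \oo --> l.
Proof.
move=> hl.
pose y c := 2 * mmzv_trunc R (core r q) (2 * c.+1).
have y0 c : 0 <= y c by rewrite mulr_ge0// mmzv_trunc_ge0// no_bar_core.
pose f (n c : nat) := gharm R 1 n * cbin R n * (y c / c.+1%:R * conn R n c.+1).
apply: (@series_interchange _ f _ _ _ _ _ _ hl).
- move=> n c; apply: mulr_ge0; first by rewrite mulr_ge0 ?gharm_ge0 ?cbin_ge0.
  by rewrite mulr_ge0 ?conn_ge0// divr_ge0.
- case=> [|n].
    rewrite /f /gharm big_geq// !mul0r; apply: cvg_series0 => c.
    by rewrite !mul0r.
  apply: cvg_seriesMl.
  have := @series_core_conn r q n.+1 isT => /cvg_series_behead; apply.
  by rewrite /= invr0 mulr0 mul0r.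
- move=> c.
  apply: eq_cvg_series (cvg_seriesMl (y c) (@series_harm_cbin_conn R c)) => n.
  by rewrite /f; ring.
Qed.

End transport.

(** * Mixed zeta values with odd leading index *)

Section odd_series.
Variable R : realType.

Lemma series_odd (u : nat -> R) M : (forall j, u (2 * j)%N = 0) ->
  series u M = series (fun j => u (2 * j + 1)%N) M./2.
Proof.
move=> u0; have sE b : series u (2 * b)%N = series (fun j => u (2 * j + 1)%N) b.
  by rewrite series_double; congr (series _ b); apply/funext => j; rewrite u0 add0r.
rewrite -{1}(odd_double_half M) -mul2n; case: odd; last by rewrite add0n sE.
by rewrite add1n seriesSr u0 addr0 sE.
Qed.

Lemma cvg_series_odd (u : nat -> R) (l : R) : (forall j, u (2 * j)%N = 0) ->
  series (fun j => u (2 * j + 1)%N) @ \oo --> l -> series u @ \oo --> l.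
Proof.
move=> u0 ul.
rewrite (_ : series u = series (fun j => u (2 * j + 1)%N) \o half).
  apply: cvg_comp ul => P [N _ NP]; exists (2 * N)%N => // M /= NM.
  by apply: NP => /=; lia.
by apply/funext => M; exact: series_odd.
Qed.

Variables (s : seq mzv_entry) (L : R).
Hypothesis s_no_bar : no_bar s.

Let y N := mmzv_trunc R s N.

(** For the odd index [n = 2j + 1], [y n] sums over indices below [n] and [alt_tail R j] is the
    alternating tail from [n] on. *)
Hypothesis y_tail : series
  (fun j => y (2 * j + 1) * (alt_tail R j / (2 * j + 1)%:R)) @ \oo --> L.

Let y0 N : 0 <= y N. Proof. exact: mmzv_trunc_ge0. Qed.

Let F (n : nat) : R := deco_coef R Tilde n / n%:R ^+ 2 * y n.

Let F_ge0 n : 0 <= F n.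
Proof. by rewrite mulr_ge0// divr_ge0 ?exprn_ge0// deco_coef_ge0. Qed.

Let F_even j : F (2 * j) = 0.
Proof. by rewrite /F deco_tilde_even !mul0r. Qed.

Let F_odd j : F (2 * j + 1) = 2 / (2 * j + 1)%:R ^+ 2 * y (2 * j + 1).
Proof. by rewrite /F deco_tilde_odd. Qed.

(** Comparison with [y_tail]: at [n = 2j + 1], [alt_tail_ge] bounds [2 / n^2] by
    [4 * alt_tail R j / n]. *)
Lemma is_cvg_mmzv_tilde2 : mmzv_cvg R (tilde_ 2 :: s).
Proof.
have : cvgn (series (fun j => F (2 * j + 1))).
  apply: (series_le_cvg (v_ := _) _ _ _ (cvgP _ (cvg_seriesMl 4 y_tail))) => j //=.
    by rewrite !mulr_ge0// ?invr_ge0// alt_tail_ge0.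
  rewrite F_odd [leLHS](_ : _ = 4 * (y (2 * j + 1) *
      ((2 * j + 1)%:R^-1 / 2 / (2 * j + 1)%:R))); last first.
    by rewrite -exprVn; move: ((2 * j + 1)%:R^-1) => x; field.
  do 2 apply: ler_wpM2l => //.
  by rewrite ler_wpM2r ?invr_ge0// alt_tail_ge.
move=> /cvg_ex[/= l hl]; apply/cvg_ex; exists l.
rewrite (_ : mmzv_trunc R (tilde_ 2 :: s) = series F); first exact: cvg_series_odd hl.
by apply/funext => N; rewrite mmzv_truncE.
Qed.

Let c (n : nat) : R := deco_coef R Tilde n / n%:R * y n.

Let c_ge0 n : 0 <= c n.
Proof. by rewrite mulr_ge0// divr_ge0// deco_coef_ge0. Qed.

Let Z M : mmzv_trunc R (tilde_ 1 :: s) M = series c M.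
Proof. by rewrite mmzv_truncE. Qed.

(* Summation by parts in the two outermost indices. *)
Let bar_tilde M : mmzv_trunc R [:: bar_ 1, tilde_ 1 & s] M =
  series c M * (alt_harm R M + alt_sum R) -
  series (fun n => c n * (alt_harm R n.+1 + alt_sum R)) M.
Proof.
rewrite mmzv_truncE; elim: M => [|M IH].
  by rewrite !seriesEnat/= !big_geq//; ring.
rewrite seriesSr IH Z !seriesSr /alt_harm seriesSr /= expr1; ring.
Qed.

(** In [bar_tilde] the boundary term vanishes in the limit. In the other sum only [n = 2j + 1]
    contributes, with alternating tail [alt_tail R j - 1 / n]; the part [1 / n] rebuilds the value
    led by [tilde_ 2]. *)
Lemma mmzv_bar1_tilde1 : mmzv_trunc R [:: bar_ 1, tilde_ 1 & s] @ \oo -->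
  mmzv R (tilde_ 2 :: s) - 2 * L.
Proof.
have Fl : series F @ \oo --> mmzv R (tilde_ 2 :: s).
  rewrite (_ : series F = mmzv_trunc R (tilde_ 2 :: s)).
    exact: is_cvg_mmzv_tilde2.
  by apply/funext => N; rewrite mmzv_truncE.
(* Kronecker's lemma applies because [c n / (n + 1) <= F n] is summable, and the alternating factor
   is at most [2 * harmonic M]. *)
have Z0 : (fun M => series c M * (alt_harm R M + alt_sum R)) @ \oo --> (0 : R).
  have cc : cvgn (series (fun n => c n * harmonic n)).
    apply: (series_le_cvg (v_ := F)); [|exact: F_ge0| |exact: cvgP Fl].
      by move=> n; rewrite mulr_ge0// harmonic_ge0.
    case=> [|n].
      by rewrite /c /= expr0 subrr !mul0r.
    have -> : F n.+1 = c n.+1 / n.+1%:R by rewrite /F /c expr2 invfM; ring.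
    apply: ler_wpM2l => //.
    by rewrite /harmonic/= lef_pV2 ?posrE ?ltr0n// ler_nat.
  have h_noninc : {homo (@harmonic R) : a b / (a <= b)%N >-> b <= a}.
    by move=> a b ab; rewrite /harmonic/= lef_pV2 ?posrE ?ltr0n// ler_nat ltnS.
  have := kronecker c_ge0 (@harmonic_ge0 R) h_noninc (@cvg_harmonic R) cc.
  move=> /(cvgMl_tmp (a := 2)); rewrite mulr0 => k0.
  apply/cvgr0Pnorm_le => e e0; move/cvgr0Pnorm_le: k0 => /(_ e e0).
  apply: filterS => M; apply: le_trans.
  have sc : 0 <= series c M by exact: sumr_ge0.
  rewrite normrM (ger0_norm sc) [leRHS]ger0_norm.
    rewrite mulrCA ler_wpM2l//; exact: alt_harm_approx.
  by rewrite !mulr_ge0// harmonic_ge0.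
have T : series (fun n => c n * (alt_harm R n.+1 + alt_sum R)) @ \oo -->
    2 * L - mmzv R (tilde_ 2 :: s).
  have F1 : series (fun j => F (2 * j + 1)) @ \oo --> mmzv R (tilde_ 2 :: s).
    have Fd : series F \o (muln 2) @ \oo --> mmzv R (tilde_ 2 :: s).
      apply: cvg_comp Fl => P [N _ NP]; exists N => // M /= NM.
      by apply: NP => /=; lia.
    rewrite (_ : series _ = series F \o (muln 2))//.
    apply/funext => b; rewrite /= series_double; congr (series _ b).
    by apply/funext => j; rewrite F_even add0r.
  apply: cvg_series_odd => [j|].
    by rewrite /c deco_tilde_even !mul0r.
  have := cvg_seriesB (cvg_seriesMl 2 y_tail) F1.
  apply: eq_cvg_series => j.
  rewrite /c (_ : (2 * j + 1).+1 = 2 * j + 2)%N; last by lia.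
  rewrite alt_harm_even_tail deco_tilde_odd F_odd -exprVn.
  by move: ((2 * j + 1)%:R^-1) => x; ring.
rewrite (_ : mmzv_trunc _ _ = fun M => series c M * (alt_harm R M + alt_sum R) -
  series (fun n => c n * (alt_harm R n.+1 + alt_sum R)) M); last exact/funext/bar_tilde.
by rewrite -opprB -sub0r; exact: cvgB.
Qed.

End odd_series.

(** * Central binomial sums with harmonic numbers, and assembly of the identity *)

Lemma apery_partialE (R : realType) (a : nat -> R) r N :
  apery_partial a r.+1 N = series (fun n => a n * cbin R n / n%:R ^+ r.+1) N.
Proof.
case: N => [|N]; first by rewrite seriesEnat/= /apery_partial !big_geq.
rewrite seriesEnat/= [RHS]big_nat_recl//= expr0n/= invr0 mulr0 add0r.
rewrite /apery_partial big_add1; apply: eq_bigr => n _.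
by rewrite /cbin invfM !mulrA.
Qed.

Lemma is_cvg_apery_harm (R : realType) r :
  cvgn (series (fun n => gharm R 1 n * cbin R n / n%:R ^+ r.+1)).
Proof.
apply: (series_le_cvg _ _ _ (@is_cvg_harm_cbin_inv R)) => n.
- by rewrite divr_ge0 ?exprn_ge0// mulr_ge0 ?gharm_ge0 ?cbin_ge0.
- by rewrite divr_ge0// mulr_ge0 ?gharm_ge0 ?cbin_ge0.
- rewrite ler_wpM2l ?mulr_ge0 ?gharm_ge0 ?cbin_ge0//.
  case: n => [|n]; first by rewrite expr0n.
  by rewrite lef_pV2 ?posrE ?exprn_gt0 ?ltr0n// ler_eXnr// ler1n.
Qed.

Theorem theorem2p7 (R : realType) (m p : nat) (hm : (1 <= m)%N) (hp : (1 <= p)%N) :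
  let HH := fun n : nat => gharm R 1 n * gharm R m.+1 n in
  let H := fun n : nat => gharm R 1 n in
  let s1 := [:: bar_ 1; tilde_ 1] ++ nseq p.-1 (hat_ 1)
              ++ [:: hat_ 2] ++ nseq m.-1 (hat_ 1) in
  let s2 := [:: tilde_ 2] ++ nseq p.-1 (hat_ 1)
              ++ [:: hat_ 2] ++ nseq m.-1 (hat_ 1) in
  [/\ apery_cvg HH p, apery_cvg H p,
      mmzv_cvg R s1, mmzv_cvg R s2 & mmzv_cvg R [:: plain_ m.+1]]
  /\ apery_sum HH p =
       4 * mmzv R s1 - 4 * mmzv R s2 + zeta_nat R m.+1 * apery_sum H p.
Proof.
case: m hm => [//|q] _; case: p hp => [//|r] _; rewrite [r.+1.-1]/= [q.+1.-1]/=.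
move=> HH H s1 s2.
have apE (a : nat -> R) : apery_partial a r.+1 =
    series (fun n => a n * cbin R n / n%:R ^+ r.+1).
  by apply/funext => N; exact: apery_partialE.
pose t n := zeta_nat R q.+2 - gharm R q.+2 n.
have zc : mmzv_cvg R [:: plain_ q.+2].
  by rewrite /mmzv_cvg zeta_truncE; exact: cvgP (@is_cvg_zeta R q.+1 isT).
have Hc : apery_cvg H r.+1 by rewrite /apery_cvg apE; exact: is_cvg_apery_harm.
have t0 n : 0 <= t n.
  have := series_le_lim 0 _ (@series_zeta_tail R q.+1 n isT).
  rewrite seriesEnat/= big_geq//; apply => k.
  by case: ifP => // _; rewrite invr_ge0 exprn_ge0.
have HC0 n : 0 <= H n * cbin R n / n%:R ^+ r.+1.
  by rewrite divr_ge0 ?exprn_ge0// mulr_ge0 ?gharm_ge0 ?cbin_ge0.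
have Hl : series (fun n => H n * cbin R n / n%:R ^+ r.+1) @ \oo -->
    apery_sum H r.+1.
  by rewrite -apE.
pose u n := H n * cbin R n * (t n / n%:R ^+ r.+1).
(* Dominated by [zeta(m+1)] times the series of [H], since [0 <= t n <= zeta(m+1)]. *)
have /cvg_ex[/= l ul] : cvgn (series u).
  apply: (series_le_cvg _ _ _ (cvgP _ (cvg_seriesMr (zeta_nat R q.+2) Hl))) => n.
  - by rewrite /u !mulr_ge0 ?gharm_ge0 ?cbin_ge0 ?invr_ge0 ?exprn_ge0.
  - by rewrite mulr_ge0// -[zeta_nat _ _]subr0; have := t0 0%N; rewrite /t /gharm big_geq.
  - rewrite /u (_ : _ * (_ / _) = H n * cbin R n / n%:R ^+ r.+1 * t n); last by ring.
    rewrite ler_wpM2l//.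
    by rewrite lerBlDr lerDl gharm_ge0.
have HHl : series (fun n => HH n * cbin R n / n%:R ^+ r.+1) @ \oo -->
    zeta_nat R q.+2 * apery_sum H r.+1 - l.
  have := cvg_seriesB (cvg_seriesMl (zeta_nat R q.+2) Hl) ul.
  by apply: eq_cvg_series => n; rewrite /u /t /HH /H; ring.
(* The block starts with a hat whether or not [r] is zero, as [mmzv_trunc_hat_odd] requires. *)
have hat_head : exists k s', core r q = hat_ k.+1 :: s'.
  by case: (r) => [|r']; [exists 1%N|exists 0%N]; eexists; reflexivity.
(* The [8^-1] removes the factors 2 and 4 of [series_core_alt_tail]. *)
have yl : series (fun j => mmzv_trunc R (core r q) (2 * j + 1) *
    (alt_tail R j / (2 * j + 1)%:R)) @ \oo --> 8^-1 * l.
  apply: eq_cvg_series (cvg_seriesMl 8^-1 (series_core_alt_tail ul)) => j.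
  have [k [s' ->]] := hat_head; rewrite mmzv_trunc_hat_odd.
  by move: ((2 * j + 1)%:R^-1) => x; field.
have s2c := is_cvg_mmzv_tilde2 (no_bar_core r q) yl.
have s1l := mmzv_bar1_tilde1 (no_bar_core r q) yl.
split.
  split => //; first by rewrite /apery_cvg apE; exact: cvgP HHl.
  exact: cvgP s1l.
(* With [L = l / 8] the first mixed value is the second minus [l / 4], so four times their
   difference is [- l]. *)
rewrite {1}/apery_sum apE (cvg_lim _ HHl)//.
by rewrite [mmzv R s1](cvg_lim _ s1l)//; field.
Qed.
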